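(* Let $J=-J^{\top}\in\mathbb{R}^{N\times N}$ be a skew-symmetric matrix and let $R=R^{\top}\in\mathbb{R}^{N\times N}$ be a positive semi-definite matrix. If $R\neq 0$ and the matrix $J-R$ is invertible, then for every integer $r$ with $1\le r\le N$ and for almost every matrix $U\in\mathbb{R}^{N\times r}$ it holds that $$\det\big(U^{\top}(J-R)^{-1}U\big)\neq 0 .$$
   Context: ''Almost every'' is with respect to the Lebesgue measure on $\mathbb{R}^{N\times r}\cong\mathbb{R}^{Nr}$. *)

(* Defs.v *)
From HB Require Import structures.
From mathcomp Require Import all_boot all_order all_algebra.
From mathcomp Require Import all_classical all_reals all_analysis.
Import Order.TTheory GRing.Theory Num.Theory.
Import numFieldNormedType.Exports.

Set Implicit Arguments.
Unset Strict Implicit.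
Unset Printing Implicit Defensive.

Local Open Scope classical_set_scope.
Local Open Scope ring_scope.

Definition psdmx (K : realType) (N : nat) (A : 'M[K]_N) : Prop :=
  forall x : 'cV[K]_N, 0 <= (x^T *m A *m x) 0 0.

Definition measure_matrix_display : measure_display -> measure_display.
Proof. exact. Qed.

(* The sigma-algebra generated by the entries, as in the library's instance
   for tuples. For T := R it is the Borel sigma-algebra of R^(m * n). *)
Section measurable_matrix.
Context {d : measure_display} {T : sigmaRingType d} (m n : nat).

Let entries (k : 'I_(m * n)) (U : 'M[T]_(m, n)) : T := mxvec U ord0 k.

Let matrix_set0 : g_sigma_preimage entries set0.
Proof. exact: sigma_algebra0. Qed.

Let matrix_setC A : g_sigma_preimage entries A ->
  g_sigma_preimage entries (~` A).
Proof. exact: sigma_algebraC. Qed.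

Let matrix_bigcup (F : _^nat) : (forall i, g_sigma_preimage entries (F i)) ->
  g_sigma_preimage entries (\bigcup_i (F i)).
Proof. exact: sigma_algebra_bigcup. Qed.

HB.instance Definition _ := @isMeasurable.Build (measure_matrix_display d)
  'M[T]_(m, n) (g_sigma_preimage entries) matrix_set0 matrix_setC matrix_bigcup.

Lemma measurable_entries (k : 'I_(m * n)) :
  measurable_fun [set: 'M[T]_(m, n)] (fun U => mxvec U ord0 k).
Proof.
move=> _ Y mY; rewrite setTI; apply: sub_sigma_algebra => /=.
rewrite -bigcup_seq/=; exists k => /=; first by rewrite mem_index_enum.
by exists Y => //; rewrite setTI.
Qed.

End measurable_matrix.

Lemma measurable_fun_matrixP d1 d2 (T1 : measurableType d1)
    (T2 : measurableType d2) m n (f : T1 -> 'M[T2]_(m, n)) :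
  (forall k, measurable_fun [set: T1] (fun x => mxvec (f x) ord0 k)) ->
  measurable_fun [set: T1] f.
Proof.
set entries := fun (k : 'I_(m * n)) (U : 'M[T2]_(m, n)) => mxvec U ord0 k.
move=> mf; suff fS : g_sigma_preimage (fun k => entries k \o f) `<=` measurable.
  rewrite g_sigma_preimage_comp in fS.
  by move=> _ A mA; apply: fS; exists A.
apply: smallest_sub; first exact: sigma_algebra_measurable.
move=> A; rewrite -bigcup_seq => -[k _ [B mB <-]].
exact: mf.
Qed.

Section lebesgue_tuple.
Context {K : realType}.
Local Notation RK := (measurableTypeR K).
Local Open Scope ereal_scope.

Definition tuple_cons (n : nat) (x : RK * n.-tuple RK) : n.+1.-tuple RK :=
  [tuple of x.1 :: x.2].

(* The n-fold product of the one-dimensional Lebesgue measure. The type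
   [measurableTypeR K] is K with its Borel sigma-algebra. See
   [lebesgue_tuple_box] for the value on boxes. *)
Fixpoint lebesgue_tuple (n : nat) : set (n.-tuple RK) -> \bar K :=
  match n with
  | 0 => dirac [tuple]
  | p.+1 => pushforward (lebesgue_measure \x @lebesgue_tuple p) (@tuple_cons p)
  end.

Definition matrix_of_tuple (m n : nat) (t : (m * n).-tuple RK) :
    'M[RK]_(m, n) := vec_mx (\row_(k < m * n) tnth t k).

(* Lebesgue measure on matrices, through the identification of an m x n matrix
   with the list of its m * n entries. It is the usual one: a sigma-finite
   measure that agrees with the product of the lengths on boxes
   ([lebesgue_matrix_box]). The sigma-algebra is the Borel one, but this does
   not affect "almost everywhere": [negligible] sets are the subsets of
   measurable sets of measure zero. *)
Definition lebesgue_matrix (m n : nat) : set 'M[RK]_(m, n) -> \bar K :=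
  pushforward (@lebesgue_tuple (m * n)) (@matrix_of_tuple m n).

Lemma measurable_tuple_cons n : measurable_fun setT (@tuple_cons n).
Proof.
by apply: (measurable_cons (f := fst) (g := snd)).
Qed.

Lemma sigma_finite_pushforward d1 d2 (T1 : measurableType d1)
    (T2 : measurableType d2) (mu : {sigma_finite_measure set T1 -> \bar K})
    (f : T1 -> T2) (g : T2 -> T1) :
  measurable_fun setT f -> measurable_fun setT g -> cancel f g ->
  exists nu : {sigma_finite_measure set T2 -> \bar K}, pushforward mu f = nu.
Proof.
move=> mf mg fK.
pose m : {measure set T2 -> \bar K} :=
  measure_function_pushforward__canonical__measure_function_Measure mu mf.
have m_sf : sigma_finite setT m.
  have [F TF mF] := sigma_finiteT mu.
  exists (fun k => g @^-1` F k).
    by rewrite -preimage_bigcup -TF preimage_setT.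
  move=> k; have [mFk Fkoo] := mF k; split.
    by rewrite -[X in measurable X]setTI; exact: mg.
  rewrite /m /= /pushforward -comp_preimage (_ : g \o f = id) //.
  by apply/funext => x /=; rewrite fK.
pose M : {sigma_finite_measure set T2 -> \bar K} :=
  HB.pack (Measure.sort m) (Measure_isSigmaFinite.Build _ _ _ m m_sf).
by exists M.
Qed.

Definition tuple_of_matrix (m n : nat) (U : 'M[RK]_(m, n)) :
    (m * n).-tuple RK := [tuple mxvec U ord0 k | k < m * n].

Lemma matrix_of_tupleK m n : cancel (@matrix_of_tuple m n) (@tuple_of_matrix m n).
Proof.
move=> t; apply: eq_from_tnth => k.
by rewrite tnth_mktuple /matrix_of_tuple vec_mxK mxE.
Qed.

Lemma tuple_of_matrixK m n : cancel (@tuple_of_matrix m n) (@matrix_of_tuple m n).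
Proof.
move=> U; rewrite /matrix_of_tuple; apply: (can_inj mxvecK); rewrite vec_mxK.
by apply/rowP => k; rewrite mxE tnth_mktuple.
Qed.

Lemma measurable_tuple_of_matrix m n :
  measurable_fun setT (@tuple_of_matrix m n).
Proof.
apply/measurable_fun_tnthP => k.
rewrite (_ : _ \o _ = fun U => mxvec U ord0 k); first exact: measurable_entries.
by apply/funext => U /=; rewrite tnth_mktuple.
Qed.

Lemma measurable_matrix_of_tuple m n :
  measurable_fun setT (@matrix_of_tuple m n).
Proof.
apply: measurable_fun_matrixP => k.
rewrite (_ : (fun _ => _) = (@tnth _ RK)^~ k); first exact: measurable_tnth.
by apply/funext => t; rewrite /matrix_of_tuple vec_mxK mxE.
Qed.

(* The library's sigma-finite instance for [m1 \x m2] is shadowed by the one it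
   later declares for subprobabilities, hence this direct construction. *)
Lemma product_measure_sfm d1 d2 (T1 : measurableType d1)
    (T2 : measurableType d2) (m1 : {sigma_finite_measure set T1 -> \bar K})
    (m2 : {sigma_finite_measure set T2 -> \bar K}) :
  exists m : {sigma_finite_measure set (T1 * T2)%type -> \bar K}, m1 \x m2 = m.
Proof.
pose m : {measure set (T1 * T2)%type -> \bar K} := m1 \x m2.
have m_sf : sigma_finite setT m.
  have /sigma_finiteP[F [TF ndF Foo]] := sigma_finiteT m1.
  have /sigma_finiteP[G [TG ndG Goo]] := sigma_finiteT m2.
  exists (fun n => F n `*` G n).
    rewrite -setXTT TF TG predeqE => -[x y]; split.
      move=> [/= [n _ Fnx] [k _ Gky]]; exists (maxn n k) => //; split.
      - by move: x Fnx; exact/subsetPset/ndF/leq_maxl.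
      - by move: y Gky; exact/subsetPset/ndG/leq_maxr.
    by move=> [n _ []/= ? ?]; split; exists n.
  move=> k; have [? ?] := Foo k; have [? ?] := Goo k.
  split; first exact: measurableX.
  by rewrite /m /= product_measure1E// lte_mul_pinfty// ge0_fin_numE.
pose M : {sigma_finite_measure set (T1 * T2)%type -> \bar K} :=
  HB.pack (Measure.sort m) (Measure_isSigmaFinite.Build _ _ _ m m_sf).
by exists M.
Qed.

Lemma lebesgue_tuple_measure n :
  exists mu : {sigma_finite_measure set (n.-tuple RK) -> \bar K},
    @lebesgue_tuple n = mu.
Proof.
elim: n => [|n [mu IH]] /=.
  pose m : {measure set (0.-tuple RK) -> \bar K} := dirac [tuple].
  have m_sf : sigma_finite setT m.
    by apply: fin_num_fun_sigma_finite; [rewrite measure0|exact: fin_num_measure].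
  pose M : {sigma_finite_measure set (0.-tuple RK) -> \bar K} :=
    HB.pack (Measure.sort m) (Measure_isSigmaFinite.Build _ _ _ m m_sf).
  by exists M.
have [pm pmE] := product_measure_sfm (@lebesgue_measure K) mu.
rewrite IH pmE.
pose g (t : n.+1.-tuple RK) : (RK * n.-tuple RK)%type :=
  (thead t, [tuple of behead t]).
apply: (@sigma_finite_pushforward _ _ _ _ pm (@tuple_cons n) g
  (@measurable_tuple_cons n)).
- apply/measurable_fun_pairP; split; last exact: measurable_behead.
  exact: measurable_tnth.
- by case=> x t /=; congr pair; apply/val_inj.
Qed.

Lemma lebesgue_tuple_box n (A : 'I_n -> set RK) :
  (forall i, measurable (A i)) ->
  lebesgue_tuple [set t | forall i, A i (tnth t i)] =
  \prod_(i < n) lebesgue_measure (A i).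
Proof.
elim: n A => [|n IH] A mA.
  by rewrite big_ord0 /= /dirac indicE mem_set // => -[].
have [mu muE] := lebesgue_tuple_measure n.
rewrite big_ord_recl -IH //= /pushforward muE.
rewrite -product_measure1E //; last first.
  rewrite (_ : mkset _ =
      \bigcap_(i in [set: 'I_n]) ((@tnth n RK)^~ i @^-1` A (lift ord0 i))).
    apply: fin_bigcap_measurable => // i _; rewrite -[X in measurable X]setTI.
    exact: measurable_tnth.
  by apply/seteqP; split=> t At i; [move=> _|]; exact: At.
congr (_ \x _) => //; apply/seteqP; split=> -[x t] /=.
  move=> At; split; first exact: (At ord0).
  by move=> i; have := At (lift ord0 i); rewrite tnthS.
by move=> [Ax At] i; case: (unliftP ord0 i) => [j ->|-> //]; rewrite tnthS.
Qed.

Lemma lebesgue_matrix_measure m n :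
  exists mu : {sigma_finite_measure set 'M[RK]_(m, n) -> \bar K},
    @lebesgue_matrix m n = mu.
Proof.
have [mu muE] := lebesgue_tuple_measure (m * n).
rewrite /lebesgue_matrix muE; apply: (@sigma_finite_pushforward _ _ _ _ _ _
  (@tuple_of_matrix m n)).
- exact: measurable_matrix_of_tuple.
- exact: measurable_tuple_of_matrix.
- exact: matrix_of_tupleK.
Qed.

Let lebesgue_matrix0 m n : @lebesgue_matrix m n set0 = 0.
Proof. by have [mu ->] := lebesgue_matrix_measure m n. Qed.

Let lebesgue_matrix_ge0 m n A : 0 <= @lebesgue_matrix m n A.
Proof. by have [mu ->] := lebesgue_matrix_measure m n. Qed.

Let lebesgue_matrix_sigma_additive m n :
  semi_sigma_additive (@lebesgue_matrix m n).
Proof.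
have [mu ->] := lebesgue_matrix_measure m n.
exact: measure_semi_sigma_additive.
Qed.

HB.instance Definition _ m n := isMeasure.Build _ _ _ (@lebesgue_matrix m n)
  (lebesgue_matrix0 m n) (@lebesgue_matrix_ge0 m n)
  (@lebesgue_matrix_sigma_additive m n).

Let lebesgue_matrix_sigma_finite m n :
  sigma_finite setT (@lebesgue_matrix m n).
Proof.
by have [mu ->] := lebesgue_matrix_measure m n; exact: sigma_finiteT.
Qed.

HB.instance Definition _ m n := Measure_isSigmaFinite.Build _ _ _
  (@lebesgue_matrix m n) (@lebesgue_matrix_sigma_finite m n).

Lemma lebesgue_matrix_box m n (A : 'I_m -> 'I_n -> set RK) :
  (forall i j, measurable (A i j)) ->
  lebesgue_matrix [set U : 'M[RK]_(m, n) | forall i j, A i j (U i j)] =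
  \prod_(i < m) \prod_(j < n) lebesgue_measure (A i j).
Proof.
move=> mA; pose B (k : 'I_(m * n)) : set RK :=
  let ij := enum_val (cast_ord (esym (mxvec_cast m n)) k) in A ij.1 ij.2.
have BE i j : B (mxvec_index i j) = A i j.
  by rewrite /B /mxvec_index cast_ordK enum_rankK.
rewrite /lebesgue_matrix /pushforward pair_bigA /=.
rewrite (_ : _ @^-1` _ = [set t | forall k, B k (tnth t k)]); last first.
  apply/seteqP; split=> t /= At.
    by case/mxvec_indexP=> i j; rewrite BE; have := At i j; rewrite !mxE.
  by move=> i j; rewrite !mxE -BE; exact: At.
rewrite lebesgue_tuple_box; last by case/mxvec_indexP=> i j; rewrite BE.
rewrite (reindex _ (curry_mxvec_bij _ _)) /=.
by apply: eq_bigr => -[i j] _ /=; rewrite BE.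
Qed.

End lebesgue_tuple.

(* Main.v *)
(* The symmetric part of B = (R - J)^-1 is positive semidefinite and nonzero,
   because q_B((R - J) y) = y^T R y where q_B(x) = x^T B x. The vectors x with
   q_{B^-1}(x) <> 0 are exactly those for which B restricts to a nondegenerate
   form on the orthogonal of x; two of them are chosen so that their
   orthogonals span the space, and q_B cannot vanish on both since isotropic
   vectors of a nonnegative form are closed under addition. Removing one
   dimension at a time gives, for every r, some U with
   det(U^T (J - R)^-1 U) <> 0. This determinant is a polynomial in the entries
   of U, hence its zero set is null, by Fubini and the finiteness of the set of
   roots of a nonzero univariate polynomial. *)

Require Import Defs.
From mathcomp Require Import all_boot all_order all_algebra.
From mathcomp Require Import all_classical all_reals all_analysis.
From mathcomp Require Import finmap ring.
Import Order.TTheory GRing.Theory Num.Theory.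
Import numFieldNormedType.Exports.
Set Implicit Arguments.
Unset Strict Implicit.
Unset Printing Implicit Defensive.

Local Open Scope classical_set_scope.
Local Open Scope ring_scope.

(** * Zero sets of polynomial functions *)

Lemma finite_rootset (K : idomainType) (p : {poly K}) : p != 0 ->
  finite_set [set x | p.[x] = 0].
Proof.
(* An infinite root set would contain at least [size p] distinct roots, too many for the degree. *)
move=> p0; apply: contrapT => /(@infinite_set_fset _ _ (size p))[B BA Bp].
have := max_poly_roots p0 _ (fset_uniq B); rewrite ltnNge Bp => H.
suff /H : all (root p) B by [].
by apply/allP => x xB; apply/eqP; exact: BA.
Qed.

Section polynomial_on_curves.
Context {K : realType}.
Local Notation RK := (measurableTypeR K).

(* Stands in for "[f] is a multivariate polynomial", and passes to slices. *)
Definition polynomial_on_curves n (f : n.-tuple RK -> RK) :=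
  forall q : 'I_n -> {poly K}, exists p : {poly K},
    forall x : K, f [tuple (q i).[x] | i < n] = p.[x].

Lemma polynomial_on_curves_slice n (f : n.+1.-tuple RK -> RK) x :
  polynomial_on_curves f ->
  polynomial_on_curves (fun t : n.-tuple RK => f (tuple_cons (x, t))).
Proof.
(* The curve [q] is extended by the constant first coordinate [x]. *)
move=> fP q; have [p pE] := fP (fun i => oapp q x%:P (unlift ord0 i)).
exists p => y; rewrite -pE; congr f; apply: eq_from_tnth => i.
case: (unliftP ord0 i) => [j|] ->.
  by rewrite tnthS !tnth_mktuple liftK.
by rewrite tnth_mktuple unlift_none /= hornerC.
Qed.

Lemma polynomial_on_curves_head n (f : n.+1.-tuple RK -> RK) t :
  polynomial_on_curves f ->
  exists p : {poly K}, forall x : K, f (tuple_cons (x, t)) = p.[x].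
Proof.
(* The curve moves the first coordinate and freezes the others at [t]. *)
move=> fP; have [p pE] := fP (fun i => oapp (fun j => (tnth t j)%:P) 'X (unlift ord0 i)).
exists p => y; rewrite -pE; congr f; apply: eq_from_tnth => i.
case: (unliftP ord0 i) => [j|] ->.
  by rewrite tnthS !tnth_mktuple liftK /= hornerC.
by rewrite tnth_mktuple unlift_none /= hornerX.
Qed.

(** Induction by Fubini: with the tail of [t] frozen, [f] is a nonzero polynomial in the first
    coordinate. Away from its finitely many roots, the slice of [f] is nonzero at that tail, so its
    zero set is null. *)
Lemma lebesgue_tuple_zeroset n (f : n.-tuple RK -> RK) t :
  measurable_fun setT f -> polynomial_on_curves f -> f t != 0 ->
  lebesgue_tuple [set u | f u = 0] = 0%E.
Proof.
elim: n => [|n IH] in f t * => mf fP ft.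
  rewrite /= /dirac indicE memNset // => /eqP; apply/negP.
  by rewrite -(tuple0 t).
have [mu muE] := @lebesgue_tuple_measure K n.
have mA : measurable [set z | f (tuple_cons z) = 0].
  rewrite -[X in measurable X]setTI.
  exact: (measurableT_comp mf (@measurable_tuple_cons K n) measurableT
            (measurable_set1 0)).
rewrite /= /pushforward /product_measure1 muE.
set A := _ @^-1` _; rewrite -/A in mA.
rewrite (ge0_ae_eq_integral measurableT (g := cst 0%E)) ?integral0 //.
  exact: measurable_fun_xsection.
have [p pE] := polynomial_on_curves_head [tuple of behead t] fP.
have p0 : p != 0.
  apply: contraNneq ft => p0.
  by rewrite (tuple_eta t) [f _]pE p0 horner0.
exists [set x | p.[x] = 0]; split.
- exact/countable_measurable/finite_set_countable/finite_rootset.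
- exact/countable_lebesgue_measure0/finite_set_countable/finite_rootset.
move=> x /= /not_implyP[_ Ax]; apply: contrapT => px; apply: Ax.
rewrite xsectionE -muE.
apply: (IH (fun t => f (tuple_cons (x, t))) [tuple of behead t]).
- apply: (measurableT_comp mf).
  apply: (measurableT_comp (@measurable_tuple_cons K n)).
  exact: measurable_pair1.
- exact: polynomial_on_curves_slice.
- by rewrite pE; apply/eqP.
Qed.

End polynomial_on_curves.

(** * Quadratic forms and isotropic vectors *)

Definition quadf (K : realType) (n : nat) (B : 'M[K]_n) (x : 'cV[K]_n) : K :=
  (x^T *m B *m x) 0 0.

(** The parallelogram law: the mixed terms [x^T B y] and [y^T B x] cancel. *)
Lemma quadfDB (K : realType) n (B : 'M[K]_n) x y :
  quadf B (x + y) + quadf B (x - y) = quadf B x *+ 2 + quadf B y *+ 2.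
Proof.
rewrite /quadf !linearD !linearN /= !(mulmxDl, mulmxDr, mulNmx, mulmxN).
move: (x^T *m _ *m _) (x^T *m _ *m _) (y^T *m _ *m _) (y^T *m _ *m _) => a b c d.
by rewrite !mxE; ring.
Qed.

Lemma quadfZ (K : realType) n (B : 'M[K]_n) a x :
  quadf B (a *: x) = a ^+ 2 * quadf B x.
Proof.
rewrite /quadf [(a *: x)^T]linearZ /= -scalemxAr -!scalemxAl scalerA mxE.
by rewrite expr2.
Qed.

Lemma quadf_mul (K : realType) m n (B : 'M[K]_m) (U : 'M[K]_(m, n)) x :
  quadf (U^T *m B *m U) x = quadf B (U *m x).
Proof. by rewrite /quadf trmx_mul !mulmxA. Qed.

(** By the parallelogram law, the nonnegative values at [x + y] and [x - y] sum to zero. *)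
Lemma psdmx_isotropicD (K : realType) n (B : 'M[K]_n) x y : psdmx B ->
  quadf B x = 0 -> quadf B y = 0 -> quadf B (x + y) = 0.
Proof.
move=> B0 x0 y0; have := quadfDB B x y; rewrite x0 y0 mul0rn addr0.
move/eqP; rewrite paddr_eq0; [|exact: B0|exact: B0].
by case/andP=> /eqP.
Qed.

(** Isotropic vectors are closed under sums and scaling, so they cannot include a whole basis. *)
Lemma psdmx_anisotropic_delta (K : realType) n (B : 'M[K]_n) x : psdmx B ->
  quadf B x != 0 -> exists i : 'I__, quadf B (delta_mx i 0) != 0.
Proof.
move=> B0 Bx; apply/existsP; apply: contraNT Bx => /existsPn Bd.
rewrite (matrix_sum_delta x); apply/eqP.
apply: (big_ind (fun y => quadf B y = 0)) => [|y z|i _].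
- by rewrite /quadf mulmx0 mxE.
- exact: psdmx_isotropicD.
- by rewrite big_ord1 quadfZ (eqP (negPn (Bd i))) mulr0.
Qed.

Lemma quadf_trmx (K : realType) n (B : 'M[K]_n) x :
  quadf B^T x = quadf B x.
Proof.
transitivity ((x^T *m B^T *m x)^T 0 0); first by rewrite [RHS]mxE.
by rewrite !trmx_mul !trmxK mulmxA.
Qed.

(** The left side reduces to [x^T B^T x], a scalar equal to its transpose. *)
Lemma quadf_invmx (K : realType) n (B : 'M[K]_n) x : B \in unitmx ->
  quadf (invmx B) (B *m x) = quadf B x.
Proof.
move=> Bu; rewrite -[RHS]quadf_trmx /quadf trmx_mul.
by rewrite -!mulmxA (mulmxA (invmx B)) mulVmx // mul1mx.
Qed.

Lemma psdmx_invmx (K : realType) n (B : 'M[K]_n) : B \in unitmx ->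
  psdmx B -> psdmx (invmx B).
Proof.
move=> Bu B0 x; rewrite -(mulKVmx Bu x) -/(quadf _ _) quadf_invmx //.
exact: B0.
Qed.

(** * Nondegenerate restrictions to subspaces *)

(* If [w U^T B U = 0] then [w U^T B] is orthogonal to [x^perp], so
   [w U^T = l x^T B^-1]; pairing with [x] gives [l = 0]. *)
Lemma unitmx_orthogonal (K : realType) n (B : 'M[K]_n.+1) (x : 'cV[K]_n.+1) :
  B \in unitmx -> quadf (invmx B) x != 0 ->
  exists U : 'M[K]_(n.+1, n), U^T *m B *m U \in unitmx /\
    forall y : 'cV[K]_n.+1, x^T *m y = 0 -> exists z, y = U *m z.
Proof.
move=> Bu qx.
have x0 : x != 0 by apply: contraNneq qx => ->; rewrite /quadf mulmx0 mxE.
have rk : \rank (kermx x) = n.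
  by rewrite mxrank_ker -mxrank_tr rank_rV -(inj_eq trmx_inj) trmx0 trmxK x0 subn1.
have [V Vfree VE] : exists2 V : 'M[K]_(n, n.+1), row_free V & (V :=: kermx x)%MS.
  move: (row_base (kermx x)) (row_base_free (kermx x)) (eq_row_base (kermx x)).
  by rewrite rk => V; exists V.
have Vx : V *m x = 0 by apply/sub_kermxP; rewrite VE.
exists V^T; rewrite trmxK; split; last first.
  move=> y xy; have /submxP[z yz] : (y^T <= V)%MS.
    rewrite VE; apply/sub_kermxP; apply: trmx_inj.
    by rewrite trmx_mul trmxK xy trmx0.
  by exists z^T; rewrite -trmx_mul -yz trmxK.
rewrite -row_free_unit -kermx_eq0; apply/rowV0P => w /sub_kermxP.
rewrite !mulmxA => wVBV.
have xk : (w *m V *m B <= x^T)%MS.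
  have : (w *m V *m B <= kermx V^T)%MS by apply/sub_kermxP.
  move/submx_trans; apply.
  have xV : (x^T <= kermx V^T)%MS.
    by apply/sub_kermxP; rewrite -trmx_mul Vx trmx0.
  (* [kermx V^T] has dimension [n.+1 - n = 1], so the nonzero row [x^T] spans it. *)
  rewrite -(geq_leqif (mxrank_leqif_sup xV)) mxrank_ker mxrank_tr.
  by rewrite (eqP Vfree) subSnn rank_rV -(inj_eq trmx_inj) trmx0 trmxK x0.
have /sub_rVP[l wE] := xk.
have wV : w *m V = l *: (x^T *m invmx B).
  by rewrite scalemxAl -wE mulmxK.
have : w *m V *m x = 0 by rewrite -mulmxA Vx mulmx0.
rewrite wV -scalemxAl => /matrixP/(_ 0 0); rewrite [LHS]mxE [RHS]mxE => /eqP.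
rewrite mulf_eq0 -/(quadf _ _) (negPf qx) orbF => /eqP l0.
by apply: (row_free_inj Vfree); rewrite wV l0 scale0r mul0mx.
Qed.

(** Keeping a vector where the form is nonzero lets this descent by one dimension be iterated. *)
Lemma psdmx_restrict (K : realType) n (B : 'M[K]_n.+2) x :
  B \in unitmx -> psdmx B -> quadf B x != 0 ->
  exists U : 'M[K]_(n.+2, n.+1), U^T *m B *m U \in unitmx /\
    exists z, quadf (U^T *m B *m U) z != 0.
Proof.
move=> Bu B0 Bx; have B'0 := psdmx_invmx Bu B0.
have [i Bi] : exists i : 'I__, quadf (invmx B) (delta_mx i 0) != 0.
  by apply: (@psdmx_anisotropic_delta _ _ _ (B *m x)) => //; rewrite quadf_invmx.
have [j ji] : exists j : 'I_n.+2, j != i.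
  by exists (lift i ord0); rewrite eq_sym neq_lift.
pose d (k : 'I_n.+2) : 'cV[K]_n.+2 := delta_mx k 0.
(* If both signs failed, [d i + d j] and [d i - d j] would be isotropic, and so would their sum,
   twice [d i]. *)
have [s [s1 Bs]] : exists s : K, s ^+ 2 = 1 /\
    quadf (invmx B) (d i + s *: d j) != 0.
  have [Bp|Bp] := eqVneq (quadf (invmx B) (d i + d j)) 0; last first.
    by exists 1; rewrite expr1n scale1r.
  exists (- 1); rewrite sqrrN expr1n scaleN1r; split=> //.
  apply: contraNneq Bi => Bm.
  have := psdmx_isotropicD B'0 Bp Bm.
  rewrite addrACA subrr addr0 -mulr2n -scaler_nat quadfZ => /eqP.
  by rewrite mulf_eq0 sqrf_eq0 pnatr_eq0.
have [U1 [U1u U1s]] := unitmx_orthogonal Bu Bi.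
have [U2 [U2u U2s]] := unitmx_orthogonal Bu Bs.
(* The orthogonals of [e_i] and of [e_i + s e_j] span the whole space, so
   [B] is not isotropic on both. *)
pose y2 : 'cV[K]_n.+2 := x i 0 *: (d i - s *: d j).
(* [y2] is orthogonal to [d i + s *: d j] because [s ^+ 2 = 1], and it shares coordinate [i] with
   [x], so [x - y2] is orthogonal to [d i]. *)
have [|z2 y2E] := U2s y2.
  rewrite [(_ + _)^T]linearD /= [(_ *: _)^T]linearZ /= !trmx_delta mulmxDl -scalemxAl.
  rewrite -!rowE; apply/matrixP => a b; rewrite !ord1 !mxE !eqxx /=.
  rewrite (negPf ji) eq_sym (negPf ji) /=.
  by transitivity (x i 0 * (1 - s ^+ 2)); [ring|rewrite s1 subrr mulr0].
have [|z1 y1E] := U1s (x - y2).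
  rewrite trmx_delta -rowE; apply/matrixP => a b; rewrite !ord1 !mxE !eqxx /=.
  by rewrite eq_sym (negPf ji) /= mulr0 subr0 mulr1 subrr.
have [q1|q1] := eqVneq (quadf B (U1 *m z1)) 0; last first.
  by exists U1; split=> //; exists z1; rewrite quadf_mul.
have [q2|q2] := eqVneq (quadf B (U2 *m z2)) 0; last first.
  by exists U2; split=> //; exists z2; rewrite quadf_mul.
case/eqP: Bx; rewrite -(subrK y2 x) y1E y2E.
exact: psdmx_isotropicD.
Qed.

Lemma psdmx_unit_restriction (K : realType) n r (B : 'M[K]_n.+1) x :
  B \in unitmx -> psdmx B -> quadf B x != 0 -> (r <= n)%N ->
  exists U : 'M[K]_(n.+1, r.+1), U^T *m B *m U \in unitmx.
Proof.
elim: n => [|n IH] in B x * => Bu B0 Bx.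
  by rewrite leqn0 => /eqP ->; exists 1%:M; rewrite trmx1 mul1mx mulmx1.
rewrite leq_eqVlt => /predU1P[->|rn].
  by exists 1%:M; rewrite trmx1 mul1mx mulmx1.
have [U [Uu [z Uz]]] := psdmx_restrict Bu B0 Bx.
have [||//|V Vu] := IH _ z Uu.
- by move=> y; have := B0 (U *m y); rewrite -/(quadf _ _) -quadf_mul.
- exact: Uz.
by exists (U *m V); rewrite trmx_mul !mulmxA in Vu *.
Qed.

(** * Forms of skew-symmetric and symmetric matrices *)

Lemma skewmx_quadf (K : realType) n (A : 'M[K]_n) x : A = - A^T -> quadf A x = 0.
Proof.
move=> AE; suff /eqP : quadf A x *+ 2 = 0 by rewrite mulrn_eq0 => /eqP.
apply/eqP; rewrite mulr2n addr_eq0; apply/eqP.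
by rewrite -[in RHS]quadf_trmx {1}AE /quadf mulmxN mulNmx [LHS]mxE.
Qed.

(** Polarization: if the form vanished, its value at [e_i + e_j] would be [2 A_ij], forcing
    [A = 0]. *)
Lemma symmx_quadf_neq0 (K : realType) n (A : 'M[K]_n) : A = A^T -> A != 0 ->
  exists x, quadf A x != 0.
Proof.
move=> AE A0; apply/not_existsP => Aq; case/eqP: A0; apply/matrixP => i j.
have q0 x : quadf A x = 0 by apply/eqP; apply: contrapT => /negP/Aq.
pose a : 'M[K]_1 := (delta_mx i 0)^T *m A *m delta_mx j 0.
have aE : a 0 0 = A i j by rewrite /a trmx_delta -rowE -colE !mxE.
have bE : ((delta_mx j 0)^T *m A *m delta_mx i 0 : 'M[K]_1) = a^T.
  by rewrite /a !trmx_mul trmxK -AE mulmxA.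
have := q0 (delta_mx i 0 + delta_mx j 0); rewrite /quadf [(_ + _)^T]linearD /=.
rewrite !(mulmxDl, mulmxDr) bE -/a mxE [X in X + _]mxE [X in _ + X]mxE.
rewrite -2!/(quadf _ _) !q0 add0r addr0 [a^T 0 0]mxE aE -mulr2n => /eqP.
by rewrite mulrn_eq0 /= => /eqP ->; rewrite mxE.
Qed.

(** * Measurability and null sets for matrices *)

Section measurable_matrix_functions.
Context {d} {T : measurableType d} {K : realType}.

Lemma measurable_mulmx m n p (A : T -> 'M[K]_(m, n)) (B : T -> 'M[K]_(n, p)) :
  (forall i j, measurable_fun setT (fun t => A t i j)) ->
  (forall i j, measurable_fun setT (fun t => B t i j)) ->
  forall i j, measurable_fun setT (fun t => (A t *m B t) i j).
Proof.
move=> mA mB i j; under eq_fun do rewrite mxE.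
by apply: measurable_sum => k; exact: measurable_realfun.measurable_funM.
Qed.

Lemma measurable_det n (A : T -> 'M[K]_n) :
  (forall i j, measurable_fun setT (fun t => A t i j)) ->
  measurable_fun setT (fun t => \det (A t)).
Proof.
move=> mA; apply: measurable_sum => s; apply: measurable_realfun.measurable_funM => //.
exact: measurable_prod.
Qed.

End measurable_matrix_functions.

Lemma lebesgue_matrix_zeroset (K : realType) m n (f : 'M[K]_(m, n) -> K) :
  measurable_fun setT (f \o @matrix_of_tuple K m n) ->
  (forall Q : 'M[{poly K}]_(m, n), exists p : {poly K},
    forall x, f (map_mx (horner_eval x) Q) = p.[x]) ->
  (exists U, f U != 0) ->
  {ae @lebesgue_matrix K m n, forall U, f U != 0}.
Proof.
move=> mf fP [U fU]; exists [set V | f V = 0]; split.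
(* Measurability is only assumed in tuple coordinates, so the zero set is written as a preimage from
   there. *)
- have -> : [set V | f V = 0] = @tuple_of_matrix K m n @^-1`
      [set t | f (matrix_of_tuple t) = 0].
    by apply/funext => V /=; rewrite tuple_of_matrixK.
  rewrite -[X in measurable X]setTI.
  apply: (@measurable_tuple_of_matrix K m n) => //.
  rewrite -[X in measurable X]setTI.
  exact: (mf measurableT _ (measurable_set1 0)).
- apply: (@lebesgue_tuple_zeroset K (m * n)%N
    (f \o @matrix_of_tuple K m n) (tuple_of_matrix U)) => //.
    move=> q; have [p pE] := fP (vec_mx (\row_k q k)).
    exists p => x; rewrite -pE /=; congr f; rewrite /matrix_of_tuple.
    by apply/matrixP => i j; rewrite !mxE tnth_mktuple.
  by rewrite /= tuple_of_matrixK.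
- by move=> V /= /negP; rewrite negbK => /eqP.
Qed.

Lemma det_congruence_ae (K : realType) m n (M : 'M[K]_m) :
  (exists U : 'M[K]_(m, n), \det (U^T *m M *m U) != 0) ->
  {ae @lebesgue_matrix K m n, forall U : 'M[K]_(m, n),
    \det (U^T *m M *m U) != 0}.
Proof.
apply: lebesgue_matrix_zeroset.
  have mU i j : measurable_fun setT
      (fun t : (m * n).-tuple (measurableTypeR K) => matrix_of_tuple t i j).
    under eq_fun do rewrite !mxE; exact: measurable_tnth.
  apply: measurable_det; apply: measurable_mulmx => //.
  apply: measurable_mulmx => // i j.
  by under eq_fun do rewrite mxE; exact: mU.
(* The same determinant is taken over [{poly K}]; evaluation at [x] is a ring morphism and commutes
   with it. *)
move=> Q; exists (\det (Q^T *m map_mx polyC M *m Q)) => x.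
rewrite -[RHS]/(horner_eval x _) -det_map_mx !map_mxM map_trmx.
rewrite (_ : map_mx _ (map_mx _ M) = M) //.
by apply/matrixP => i j; rewrite !mxE /= /horner_eval hornerC.
Qed.

(** * Application to the inverse of [J - R] *)

Theorem theorem4p2 (K : realType) (N : nat) (J R : 'M[K]_N)
  (J_skew : J = - J^T) (R_sym : R = R^T) (R_psd : psdmx R)
  (R_neq0 : R != 0) (JR_unit : J - R \in unitmx)
  (r : nat) (r_bounds : (1 <= r <= N)%N) :
  {ae @lebesgue_matrix K N r, forall U : 'M[K]_(N, r),
    \det (U^T *m invmx (J - R) *m U) != 0}.
Proof.
case: r r_bounds => [|r]; case: N => [|n] // in J R J_skew R_sym R_psd R_neq0 JR_unit *.
move=> rn; apply: det_congruence_ae.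
have [x Rx] := symmx_quadf_neq0 R_sym R_neq0.
(* The skew part contributes nothing; the sign is flipped to make the form nonnegative. *)
have qE y : quadf (- (J - R)) y = quadf R y.
  rewrite /quadf opprB mulmxBr mulmxBl mxE [X in _ + X]mxE -!/(quadf _ _).
  by rewrite (skewmx_quadf _ J_skew) oppr0 addr0.
have Bu : - (J - R) \in unitmx by rewrite -scaleN1r unitmxZ ?unitrN1.
have B0 : psdmx (- (J - R)).
  by move=> y; rewrite -/(quadf _ _) qE; exact: R_psd.
have B'u : invmx (- (J - R)) \in unitmx by rewrite unitmx_inv.
have B'x : quadf (invmx (- (J - R))) (- (J - R) *m x) != 0.
  by rewrite quadf_invmx // qE.
have [U] := psdmx_unit_restriction B'u (psdmx_invmx Bu B0) B'x rn.
have -> : invmx (- (J - R)) = - invmx (J - R).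
  by rewrite -scaleN1r invmxZ ?scaleN1r // invrN1 scaleN1r.
move=> Uu; exists U; move: Uu; rewrite mulmxN mulNmx unitmxE unitfE.
(* The sign flip only multiplies the determinant by a power of [-1]. *)
by rewrite -scaleN1r detZ mulf_eq0 negb_or => /andP[].
Qed.
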